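(* The numerical semigroup $\mathcal{S}=\langle 101,102,110,111\rangle$ is $3$-normalescent but is not a $3$-quotient.
   Context: Let $\mathbb{N}=\{0,1,2,\dots\}$. A numerical semigroup is a set $\mathcal{S}\subseteq\mathbb{N}$ that contains $0$ and is closed under addition. For positive integers $a_1,\dots,a_n$, $\langle a_1,\dots,a_n\rangle=\{a_1x_1+\cdots+a_nx_n : x_i\in\mathbb{N}\}$. For a numerical semigroup $\mathcal{T}$ and a positive integer $d$, the quotient is $\mathcal{T}/d=\{t\in\mathbb{N}: dt\in\mathcal{T}\}$. A numerical semigroup $\mathcal{S}$ is a $k$-quotient if $\mathcal{S}=\langle a_1,\dots,a_k\rangle/d$ for some positive integers $d,a_1,\dots,a_k$. A rational polyhedral cone in $\mathbb{R}^m$ is a pointed (containing no line) set of the form $\operatorname{cone}(\mathbf{v}_1,\dots,\mathbf{v}_\ell)=\{\sum_i\lambda_i\mathbf{v}_i:\lambda_i\in\mathbb{R}_{\ge 0}\}$ with $\mathbf{v}_i\in\mathbb{Z}^m$; its dimension is the dimension of its linear span. A numerical semigroup $\mathcal{S}$ is $k$-normalescent if $\mathcal{S}=\pi(\mathcal{C}\cap\mathbb{Z}^m)$ for some $m$, some $k$-dimensional rational polyhedral cone $\mathcal{C}\subseteq\mathbb{R}^m$, and some linear map $\pi:\mathbb{R}^m\to\mathbb{R}$ with integer coefficients. *)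

(* Defs.v *)
From HB Require Import structures.
From mathcomp Require Import all_boot all_order all_algebra.
From mathcomp Require Import boolp classical_sets reals.

Set Implicit Arguments.
Unset Strict Implicit.
Unset Printing Implicit Defensive.

Import GRing.Theory.

Local Open Scope classical_set_scope.

(* No cofiniteness (gcd 1) condition is imposed. *)
Record numSemigroup := NumSemigroup {
  ns_set :> set nat;
  ns_0 : ns_set 0;
  ns_add : forall a b, ns_set a -> ns_set b -> ns_set (a + b)
}.

Section Generated.
Variables (n : nat) (a : n.-tuple nat).

Definition gen_set : set nat :=
  [set s | exists x : 'I_n -> nat, s = \sum_(i < n) tnth a i * x i].

Lemma gen_set0 : gen_set 0.
Proof. by exists (fun=> 0); rewrite big1 // => i _; rewrite muln0. Qed.

Lemma gen_setD s t : gen_set s -> gen_set t -> gen_set (s + t).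
Proof.
move=> [x ->] [y ->]; exists (fun i => x i + y i).
by rewrite -big_split /=; apply: eq_bigr => i _; rewrite mulnDr.
Qed.

Definition generated : numSemigroup := NumSemigroup gen_set0 gen_setD.

End Generated.

Section Quotient.
Variables (T : numSemigroup) (d : nat).

Definition quot_set : set nat := [set t | ns_set T (d * t)].

Lemma quot_set0 : quot_set 0.
Proof. by rewrite /quot_set /= muln0; exact: ns_0. Qed.

Lemma quot_setD s t : quot_set s -> quot_set t -> quot_set (s + t).
Proof. by rewrite /quot_set /= mulnDr; exact: ns_add. Qed.

Definition semigroup_quotient : numSemigroup := NumSemigroup quot_set0 quot_setD.

End Quotient.

Definition is_quotient (k : nat) (S : numSemigroup) : Prop :=
  exists (d : nat) (a : k.-tuple nat),
    [/\ 0 < d, forall i, 0 < tnth a i &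
        S = semigroup_quotient (generated a) d :> set nat].

Local Open Scope ring_scope.

Section Cones.
Variables (R : realType) (m : nat).
Implicit Types (C : set 'rV[R]_m) (k : nat).

Definition int_lattice : set 'rV[R]_m := [set x | x \is a mxOver Num.int].

Definition cone (l : nat) (v : 'I_l -> 'rV[R]_m) : set 'rV[R]_m :=
  [set x | exists2 lam : 'I_l -> R,
     (forall i, 0 <= lam i) & x = \sum_(i < l) lam i *: v i].

Definition contains_line C : Prop :=
  exists x v : 'rV[R]_m, v != 0 /\ forall t : R, C (x + t *: v).

Definition rational_polyhedral_cone C : Prop :=
  (exists (l : nat) (v : 'I_l -> 'rV[R]_m),
     (forall i, int_lattice (v i)) /\ C = cone v) /\
  ~ contains_line C.

Definition linear_span C : set 'rV[R]_m :=
  [set x | exists2 s : seq 'rV[R]_m,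
     (forall v, v \in s -> C v) & x \in <<s>>%VS].

Definition has_dim C k : Prop :=
  exists2 U : {vspace 'rV[R]_m}, [set` U] = linear_span C & \dim U = k.

(* For a linear form, the coefficients are its values on the standard basis. *)
Definition int_coefs (pi : {linear 'rV[R]_m -> R^o}) : Prop :=
  forall i : 'I_m, (pi (delta_mx 0 i) : R) \is a Num.int.

End Cones.

Definition normalescent (R : realType) (k : nat) (S : numSemigroup) : Prop :=
  exists (m : nat) (C : set 'rV[R]_m) (pi : {linear 'rV[R]_m -> R^o}),
    [/\ rational_polyhedral_cone C, has_dim C k, int_coefs pi &
        [set (n%:R : R) | n in S] = pi @` (C `&` @int_lattice R m)].

(* Main.v *)
Require Import Defs.
From mathcomp Require Import all_boot all_order all_algebra.
From mathcomp Require Import reals.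
From HB Require Import structures.
From mathcomp Require Import boolp classical_sets.
From mathcomp Require Import zify ring lra.

(** Since 101 + 111 = 102 + 110, the semigroup is the image under
    (k, y, z) |-> 101 k + y + 9 z of the lattice points 0 <= y, z <= k of the
    cone over the unit square.

    If it were <a_0, a_1, a_2> / d, then d * 101, d * 102, d * 110, d * 111 would
    be the values of the form a . x at points X_0, .., X_3 of N^3.  An integer
    combination of the X_j which stays in N^3 must have its value in d S.  Each
    of the three coordinates is a nonnegative functional on the X_j, and excludes
    only a few of 16 combinations whose values are d times a gap of S: three
    coordinates cannot exclude all of them, just as a triangle containing a square
    must go well beyond one of its four sides. *)

Set Implicit Arguments.
Unset Strict Implicit.
Unset Printing Implicit Defensive.
Import Order.TTheory GRing.Theory Num.Theory.

Local Notation gens := [tuple 101; 102; 110; 111].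

Lemma ord3_ind (P : 'I_3 -> Prop) :
  P 0%R -> P 1%R -> P 2%:R%R -> forall i, P i.
Proof.
move=> P0 P1 P2 [[|[|[|//]]] i3].
- by rewrite (_ : Ordinal i3 = 0%R) //; apply: val_inj.
- by rewrite (_ : Ordinal i3 = 1%R) //; apply: val_inj.
- by rewrite (_ : Ordinal i3 = 2%:R%R) //; apply: val_inj.
Qed.

Lemma big_ord4 (T : Type) (idx : T) (op : Monoid.law idx) (F : 'I_4 -> T) :
  \big[op/idx]_(i < 4) F i = op (op (op (F 0%R) (F 1%R)) (F 2%:R%R)) (F 3%:R%R).
Proof.
rewrite !big_ord_recr big_ord0 /= Monoid.mul1m.
by congr (op (op (op (F _) (F _)) (F _)) (F _)); apply: val_inj.
Qed.

Lemma generated4P t : ns_set (generated gens) t <->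
  exists x y z u, t = 101 * x + 102 * y + 110 * z + 111 * u.
Proof.
split=> [[x ->]|[x [y [z [u ->]]]]].
  by do 4![eexists]; rewrite big_ord4.
exists (fun i : 'I_4 => nth 0 [:: x; y; z; u] i).
by rewrite big_ord4.
Qed.

(** * Obstruction to being a 3-quotient *)

Definition dot4 (c : seq nat) (w : 'I_4 -> nat) := \sum_(j < 4) nth 0 c j * w j.

(* The pair (p, q) encodes p - q in Z^4.  In the standard basis, these
   vectors are of the form 2 e_i + e_j + e_k - 2 e_l, with i, j, k, l distinct, or
   2 e_i + 2 e_j - e_k, with {i, j} a side of the square 101, 102, 111, 110.
   The selection and its order come from a linear programming search, and keep
   the case analysis of [witness_nonneg] below a hundred nodes. *)
Definition witnesses : seq (seq nat * seq nat) :=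
  [:: ([:: 0; 2; 1; 1], [:: 2; 0; 0; 0]); ([:: 2; 2; 0; 0], [:: 0; 0; 1; 0]);
      ([:: 2; 0; 2; 0], [:: 0; 1; 0; 0]); ([:: 2; 0; 1; 1], [:: 0; 2; 0; 0]);
      ([:: 0; 1; 2; 1], [:: 2; 0; 0; 0]); ([:: 2; 2; 0; 0], [:: 0; 0; 0; 1]);
      ([:: 2; 1; 0; 1], [:: 0; 0; 2; 0]); ([:: 2; 0; 2; 0], [:: 0; 0; 0; 1]);
      ([:: 0; 0; 2; 2], [:: 1; 0; 0; 0]); ([:: 1; 1; 0; 2], [:: 0; 0; 2; 0]);
      ([:: 0; 2; 0; 2], [:: 1; 0; 0; 0]); ([:: 1; 0; 1; 2], [:: 0; 2; 0; 0]);
      ([:: 1; 1; 2; 0], [:: 0; 0; 0; 2]); ([:: 0; 0; 2; 2], [:: 0; 1; 0; 0]);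
      ([:: 1; 2; 1; 0], [:: 0; 0; 0; 2]); ([:: 0; 2; 0; 2], [:: 0; 0; 1; 0])].

Lemma dot4E c w : dot4 c w =
  nth 0 c 0 * w 0%R + nth 0 c 1 * w 1%R + nth 0 c 2 * w 2%:R%R
    + nth 0 c 3 * w 3%:R%R.
Proof. exact: big_ord4. Qed.

Lemma witnesses_gap c : c \in witnesses ->
  exists2 t, dot4 c.1 (tnth gens) = dot4 c.2 (tnth gens) + t &
             ~ ns_set (generated gens) t.
Proof.
move=> cW; set p := dot4 c.1 _; set q := dot4 c.2 _.
suff [qp ngap] : q <= p /\ ~ ns_set (generated gens) (p - q).
  by exists (p - q); rewrite // subnKC.
rewrite generated4P /p /q {p q} !dot4E !(tnth_nth 0) /=; move: cW.
rewrite !inE; do 15![case/predU1P=> [->|] /=;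
  first by split; [lia | move=> [x [y [z [u]]]]; lia]].
by move/eqP=> -> /=; split; [lia | move=> [x [y [z [u]]]]; lia].
Qed.

Lemma witness_nonneg (w : 'I_3 -> 'I_4 -> nat) :
  exists2 c, c \in witnesses & forall i, dot4 c.2 (w i) <= dot4 c.1 (w i).
Proof.
apply: contrapT => noW.
have {noW} : all (fun c => [|| dot4 c.1 (w 0%R) < dot4 c.2 (w 0%R),
     dot4 c.1 (w 1%R) < dot4 c.2 (w 1%R) |
     dot4 c.1 (w 2%:R%R) < dot4 c.2 (w 2%:R%R)]) witnesses.
  apply/allP => c cW; rewrite !ltnNge -!negb_and; apply/negP=> /and3P[h0 h1 h2].
  by apply: noW; exists c => //; apply: ord3_ind.
rewrite /= !dot4E /= !(mul0n, add0n, mul1n, addn0).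
move: (w 0%R) (w 1%R) (w 2%:R%R) => f g h.
move: (f 0%R) (f 1%R) (f 2%:R%R) (f 3%:R%R) => f0 f1 f2 f3.
move: (g 0%R) (g 1%R) (g 2%:R%R) (g 3%:R%R) => g0 g1 g2 g3.
move: (h 0%R) (h 1%R) (h 2%:R%R) (h 3%:R%R) => h0 h1 h2 h3.
move=> {f g h}.
(* Branch, witness by witness, on a coordinate where the combination is negative; [lia] prunes
   infeasible branches at once, and none survives. *)
do 16! [case/andP => /or3P[] ?; try (exfalso; lia)].
Qed.

Lemma not_3quotient : ~ is_quotient 3 (generated gens).
Proof.
case=> d [a [_ _ E]].
have /choice[X dX] j : exists x : 'I_3 -> nat,
    d * tnth gens j = \sum_i tnth a i * x i.
  have : ns_set (generated gens) (tnth gens j).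
    exists (fun i => i == j); rewrite (bigD1 j) //= (eqxx j) muln1 big1 ?addn0 //.
    by move=> i /negPf ->; rewrite muln0.
  by rewrite E.
have dot4X (c : seq nat) : d * dot4 c (tnth gens) =
    \sum_i tnth a i * dot4 c (X^~ i).
  rewrite /dot4 big_distrr /=.
  under eq_bigr do rewrite mulnCA dX big_distrr /=.
  rewrite exchange_big /=; apply: eq_bigr => i _; rewrite big_distrr /=.
  by apply: eq_bigr => j _; rewrite mulnCA.
have [c cW c21] := witness_nonneg (fun i => X^~ i).
(* The combination [c.1 - c.2] of the points [X j] lies in N^3 and represents [d * t], which puts
   the gap [t] in the quotient. *)
have [t ct] := witnesses_gap cW; apply; rewrite E.
exists (fun i => dot4 c.1 (X^~ i) - dot4 c.2 (X^~ i)).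
(* Adding the [c.2] part to both sides undoes the truncated subtraction, by [c21]. *)
apply: (@addnI (d * dot4 c.2 (tnth gens))).
rewrite -mulnDr -ct !dot4X -big_split /=; apply: eq_bigr => i _.
by rewrite -mulnDr subnKC.
Qed.

Local Open Scope ring_scope.
Local Open Scope classical_set_scope.

(** * The cone over the unit square *)

Section SquareCone.
Variable R : realType.

(* (1, 0, 0), (1, 1, 0), (1, 0, 1) and (1, 1, 1) *)
Definition square_vertex (i : 'I_4) : 'rV[R]_3 :=
  \row_j (nth 0 [:: 1; i %% 2; i %/ 2]%N j)%:R.

(** Its values at the four vertices are 101, 102, 110 and 111. *)
Definition square_form (x : 'rV[R]_3) : R^o :=
  101 * x 0 0 + x 0 1 + 9 * x 0 2%:R.

Fact square_form_is_linear : linear square_form.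
Proof. by move=> a x y; rewrite /square_form !mxE /GRing.scale /=; ring. Qed.

HB.instance Definition _ :=
  GRing.isLinear.Build R 'rV[R]_3 R^o _ square_form square_form_is_linear.

Lemma rV3P (x y : 'rV[R]_3) :
  x 0 0 = y 0 0 -> x 0 1 = y 0 1 -> x 0 2%:R = y 0 2%:R -> x = y.
Proof. by move=> h0 h1 h2; apply/rowP; apply: ord3_ind. Qed.

Lemma square_sumE (l : 'I_4 -> R) (x := \sum_i l i *: square_vertex i) :
  [/\ x 0 0 = l 0 + l 1 + l 2%:R + l 3%:R, x 0 1 = l 1 + l 3%:R &
      x 0 2%:R = l 2%:R + l 3%:R].
Proof.
rewrite {}/x !summxE !big_ord4 /= !mxE /=.
by rewrite !(mulr0, mulr1, add0r, addr0).
Qed.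

(* The square is cut along its diagonal y + z = 1; the coefficients are
   nonnegative over the lower triangle here, over the upper one below. *)
Lemma square_lowerE (x : 'rV[R]_3) : x = \sum_(i < 4)
  nth 0 [:: x 0 0 - x 0 1 - x 0 2%:R; x 0 1; x 0 2%:R; 0] i *: square_vertex i.
Proof.
have [e0 e1 e2] := square_sumE
  (fun i => nth 0 [:: x 0 0 - x 0 1 - x 0 2%:R; x 0 1; x 0 2%:R; 0] i).
by apply: rV3P; rewrite ?e0 ?e1 ?e2 /=; ring.
Qed.

Lemma square_upperE (x : 'rV[R]_3) : x = \sum_(i < 4)
  nth 0 [:: 0; x 0 0 - x 0 2%:R; x 0 0 - x 0 1; x 0 1 + x 0 2%:R - x 0 0] i
    *: square_vertex i.
Proof.
have [e0 e1 e2] := square_sumE (fun i => nth 0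
  [:: 0; x 0 0 - x 0 2%:R; x 0 0 - x 0 1; x 0 1 + x 0 2%:R - x 0 0] i).
by apply: rV3P; rewrite ?e0 ?e1 ?e2 /=; ring.
Qed.

Lemma square_coneP x : cone square_vertex x <->
  [/\ 0 <= x 0 1, x 0 1 <= x 0 0, 0 <= x 0 2%:R & x 0 2%:R <= x 0 0].
Proof.
split=> [[l l0 ->]|[y0 yx z0 zx]].
  have [-> -> ->] := square_sumE l.
  by move: (l0 0) (l0 1) (l0 2%:R) (l0 3%:R) => *; split; lra.
have [yzx|xyz] := lerP (x 0 1 + x 0 2%:R) (x 0 0).
- rewrite [x]square_lowerE; eexists; last by [].
  by case=> [[|[|[|[|//]]]]] i4 //=; lra.
- rewrite [x]square_upperE; eexists; last by [].
  by case=> [[|[|[|[|//]]]]] i4 //=; lra.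
Qed.

Lemma square_vertex_cone i : cone square_vertex (square_vertex i).
Proof.
exists (fun j => (j == i)%:R) => [j|]; first exact: ler0n.
rewrite (bigD1 i) //= eqxx scale1r big1 ?addr0 // => j /negPf ->.
by rewrite scale0r.
Qed.

Lemma line_nonneg_const (a b : R) : (forall t, 0 <= a + t * b) -> b = 0.
Proof.
move=> ab; apply/eqP/negPn/negP=> b0.
(* This choice of [t] gives the value -1. *)
by have := ab (- (a + 1) / b); rewrite divfK //; lra.
Qed.

Lemma square_cone_rational : rational_polyhedral_cone (cone square_vertex).
Proof.
split.
  exists 4%N, square_vertex; split=> // i.
  by apply/mxOverP => j k; rewrite mxE.
case=> x [v [v0 xv]]; case/eqP: v0.
(* All three coordinates are nonnegative on the cone, hence constant along a line in it. *)
have xv_bounds t := (square_coneP (x + t *: v)).1 (xv t).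
have v1 : v 0 1 = 0.
  apply: (@line_nonneg_const (x 0 1)) => t.
  by have [+ _ _ _] := xv_bounds t; rewrite !mxE.
have v2 : v 0 2%:R = 0.
  apply: (@line_nonneg_const (x 0 2%:R)) => t.
  by have [_ _ + _] := xv_bounds t; rewrite !mxE.
have v0 : v 0 0 = 0.
  apply: (@line_nonneg_const (x 0 0)) => t.
  by have [h1 h2 _ _] := xv_bounds t; move: (le_trans h1 h2); rewrite !mxE.
by apply: rV3P; rewrite mxE.
Qed.

Lemma square_cone_dim : has_dim (cone square_vertex) 3.
Proof.
exists fullv; last by rewrite dimvf /dim /= mul1n.
apply/seteqP; split=> x _ /=; last exact: memvf.
exists [seq square_vertex i | i : 'I_4].
  by move=> v /mapP[i _ ->]; exact: square_vertex_cone.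
(* This decomposition holds for every [x], whatever the signs of its coefficients. *)
rewrite [x]square_lowerE; apply: rpred_sum => i _.
by rewrite rpredZ // memv_span // map_f // mem_enum.
Qed.

Lemma square_form_int : int_coefs square_form.
Proof.
move=> i; rewrite /= /square_form !mxE.
by do ![apply: rpredD]; do ?[apply: rpredM]; exact: natr_int.
Qed.

Lemma square_form_image :
  [set (n%:R : R) | n in ns_set (generated gens)] =
  square_form @` (cone square_vertex `&` @int_lattice R 3).
Proof.
apply/seteqP; split=> [_ [n /generated4P[x [y [z [u ->]]]] <-]|].
  set l := fun i : 'I_4 => (nth 0%N [:: x; y; z; u] i)%:R : R.
  have [e0 e1 e2] := square_sumE l.
  exists (\sum_i l i *: square_vertex i).
    split; first by exists l => // i; exact: ler0n.
    apply/mxOverP => i j; rewrite summxE rpred_sum // => k _.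
    by rewrite !mxE rpredM // natr_int.
  by rewrite /square_form e0 e1 e2 3!natrD 4!natrM /l /=; ring.
move=> _ [x [/square_coneP[y0 yx z0 zx] /mxOverP xint] <-].
have /natrP[y Ey] : x 0 1 \is a Num.nat by rewrite natrEint xint.
have /natrP[z Ez] : x 0 2%:R \is a Num.nat by rewrite natrEint xint.
have /natrP[k Ek] : x 0 0 \is a Num.nat by rewrite natrEint xint (le_trans y0).
rewrite /square_form Ey Ez Ek.
move: yx zx; rewrite Ey Ez Ek !ler_nat => yk zk.
exists (101 * k + y + 9 * z)%N; last by rewrite 2!natrD 2!natrM.
(* The coefficients of [square_lowerE] and [square_upperE] are integers at lattice points, so the
   same diagonal cut works over N. *)
apply/generated4P; have [yzk|kyz] := leqP (y + z) k.
- by exists (k - y - z)%N, y, z, 0%N; lia.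
- by exists 0%N, (k - z)%N, (k - y)%N, (y + z - k)%N; lia.
Qed.

Lemma generated_3normalescent : normalescent R 3 (generated gens).
Proof.
exists 3%N, (cone square_vertex), square_form; split.
- exact: square_cone_rational.
- exact: square_cone_dim.
- exact: square_form_int.
- exact: square_form_image.
Qed.

End SquareCone.

Local Close Scope classical_set_scope.
Local Close Scope ring_scope.

Theorem proposition1p6 (R : realType) :
  normalescent R 3 (generated [tuple 101; 102; 110; 111]) /\
  ~ is_quotient 3 (generated [tuple 101; 102; 110; 111]).
Proof. by split; [exact: generated_3normalescent | exact: not_3quotient]. Qed.
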